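(* Let $X$ be the limit of a convergent inverse sequence of metrizable uniform spaces $X_i$ and uniformly continuous maps $p_i\colon X_{i+1}\to X_i$, and let $Y$ be a metric space. (a) Suppose that $Y$ satisfies the Hahn property. Then for every uniformly continuous map $f\colon X\to Y$ and each $\varepsilon>0$ there exist a $j$ and a uniformly continuous map $g\colon X_j\to Y$ such that $f$ is $\varepsilon$-close to the composition $X\xrightarrow{p^\infty_j}X_j\xrightarrow{g}Y$. (b) Suppose that $f,g\colon X_i\to Y$ are uniformly continuous maps such that the two compositions $f\circ p^\infty_i,\ g\circ p^\infty_i\colon X\to Y$ are $\varepsilon$-close. Then for each $\delta>0$ there exists a $k$ such that the two compositions $f\circ p^k_i,\ g\circ p^k_i\colon X_k\to Y$ are $(\varepsilon+\delta)$-close.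
   Context: $p^j_i\colon X_j\to X_i$ denotes the composite bonding map and $p^\infty_i\colon X\to X_i$ the projection; $X$ is the subspace of threads in $\prod X_i$ with the product uniformity. ''$\varepsilon$-close'' means at distance at most $\varepsilon$ at every point. Let $X_{\mathbb{N}\cup\infty}$ be the inverse limit of the finite disjoint unions $X_n\sqcup\dots\sqcup X_0$ with bonding maps equal to $p_n$ on $X_{n+1}$ and to the identity on $X_n\sqcup\dots\sqcup X_0$; it contains $X$ and each $X_i$. The inverse sequence is convergent if every uniform neighborhood of $X$ in $X_{\mathbb{N}\cup\infty}$ contains all but finitely many of the $X_i$'s; equivalently, for each $i$, each uniform neighborhood of $p^\infty_i(X)$ in $X_i$ contains $p^j_i(X_j)$ for all but finitely many $j$. (A uniform neighborhood of a subset $S$ is a set containing an $\varepsilon$-neighborhood of $S$ for some $\varepsilon>0$.) A metric space $Y$ satisfies the Hahn property if for each $\varepsilon>0$ there exists a $\delta>0$ such that for every uniform space $Z$ and every $\delta$-continuous map $\Xi\colon Z\to Y$ there exists a uniformly continuous map $Z\to Y$ that is $\varepsilon$-close to $\Xi$. Here a possibly discontinuous map $\Xi$ is $\delta$-continuous if there exists a uniform cover $C$ of $Z$ such that $\Xi$ sends every element of $C$ into a set of diameter at most $\delta$. *)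

(* Defs.v *)
From HB Require Import structures.
From mathcomp Require Import all_boot all_order all_algebra.
From mathcomp Require Import all_classical all_reals all_analysis.

Set Implicit Arguments.
Unset Strict Implicit.
Unset Printing Implicit Defensive.

Import Order.TTheory GRing.Theory Num.Theory.
Local Open Scope classical_set_scope.
Local Open Scope ring_scope.

Definition unif_metrizable (R : realType) (T : uniformType) : Prop :=
  exists d : T -> T -> R,
    [/\ forall x, d x x = 0,
        forall x y, d x y = 0 -> x = y,
        forall x y, d x y = d y x,
        forall x y z, d x z <= d x y + d y z &
        entourage = entourage_ (fun x e => [set y | d x y < e])].

Definition unif_nbhd (T : uniformType) (S U : set T) : Prop :=
  exists2 E, entourage E & forall x y, S x -> E (x, y) -> U y.

Definition unif_cover (T : uniformType) (C : set (set T)) : Prop :=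
  exists2 E, entourage E &
    forall x, exists2 A, C A & forall y, E (x, y) -> A y.

(** * Metric notions *)

(* The diameter of the empty set is -oo here. *)
Definition diameter (R : realType) (Y : metricType R) (A : set Y) : \bar R :=
  ereal_sup [set (mdist u.1 u.2)%:E | u in A `*` A].

Definition eps_close (R : realType) (Y : metricType R) (T : Type)
    (f g : T -> Y) (e : R) : Prop :=
  forall x, mdist (f x) (g x) <= e.

Definition delta_continuous (R : realType) (Y : metricType R) (Z : uniformType)
    (d : R) (Xi : Z -> Y) : Prop :=
  exists2 C : set (set Z), unif_cover C &
    forall A, C A -> (diameter (Xi @` A) <= d%:E)%E.

Definition hahn_property (R : realType) (Y : metricType R) : Prop :=
  forall e : R, 0 < e -> exists2 d : R, 0 < d &
    forall (Z : uniformType) (Xi : Z -> Y), delta_continuous d Xi ->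
      exists2 h : Z -> Y, unif_continuous h & eps_close h Xi e.

(** * Limits of inverse sequences *)

(* Threads, with the uniformity that the library puts on a subset of the
   product [prod_topology X]. *)
Definition invlim (X : nat -> uniformType) (p : forall n, X n.+1 -> X n)
    : uniformType :=
  [set x : prod_topology X | forall n, p n (x n.+1) = x n].

Definition invlim_proj (X : nat -> uniformType) (p : forall n, X n.+1 -> X n)
    (i : nat) : invlim p -> X i :=
  fun x => (val x : prod_topology X) i.

(* [bond p i m] is the composite p_i \o ... \o p_(m+i-1) : X_(m+i) -> X_i.
   Writing the larger index as m + i avoids transporting along equalities
   between indices: [X (m.+1 + i)] is convertible to [X (m + i).+1]. *)
Fixpoint bond (X : nat -> uniformType) (p : forall n, X n.+1 -> X n)
    (i m : nat) : X (m + i)%N -> X i :=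
  match m with
  | 0 => fun x => x
  | m'.+1 => fun x => bond p (p (m' + i)%N x)
  end.
Arguments bond {X} p i m _.

(** * Disjoint unions of two uniform spaces *)

Section sum_uniform.
Local Open Scope relation_scope.
Context {U V : uniformType}.

(* Coproduct uniformity: no condition on the mixed pairs, so the summands are
   uniformly disjoint. *)
Definition sum_ent : set_system ((U + V) * (U + V)) :=
  [set E | entourage [set u : U * U | E (inl u.1, inl u.2)] /\
           entourage [set v : V * V | E (inr v.1, inr v.2)]].

Let sum_ent_filter : Filter sum_ent.
Proof.
split; first by split; exact: filterT.
- by move=> A B [A1 A2] [B1 B2]; split; exact: filterI.
- by move=> A B AB [A1 A2]; split; [apply: filterS A1|apply: filterS A2];
    move=> u; exact: AB.
Qed.

Let sum_ent_refl A : sum_ent A -> diagonal `<=` A.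
Proof.
move=> [A1 A2] [x y] /diagonalP ->; case: y => [u|v].
  exact: (entourage_refl u A1).
exact: (entourage_refl v A2).
Qed.

Let sum_ent_inv A : sum_ent A -> sum_ent A^-1.
Proof. by move=> [A1 A2]; split; [exact: entourage_inv A1|exact: entourage_inv A2]. Qed.

Let sum_ent_split A : sum_ent A -> exists2 B, sum_ent B & B \; B `<=` A.
Proof.
move=> [/entourage_split_ex[B1 eB1 B1A] /entourage_split_ex[B2 eB2 B2A]].
exists [set z | match z with
                | (inl u, inl u') => B1 (u, u')
                | (inr v, inr v') => B2 (v, v')
                | _ => False
                end].
  by split; [apply: filterS eB1 | apply: filterS eB2] => -[].
move=> [[u|v] [u'|v']] [[w|w]] //= B1w B2w.
  by apply: (B1A (u, u')); exists w.
by apply: (B2A (v, v')); exists w.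
Qed.

HB.instance Definition _ := @isUniform.Build (U + V)%type sum_ent
  sum_ent_filter sum_ent_refl sum_ent_inv sum_ent_split.

End sum_uniform.

(** * Convergent inverse sequences *)

Section convergence.
Variables (X : nat -> uniformType) (p : forall n, X n.+1 -> X n).

(* X_n + (X_(n-1) + (... + X_0)) *)
Fixpoint union_upto (n : nat) : uniformType :=
  match n with
  | 0 => X 0
  | m.+1 => (X m.+1 + union_upto m)%type
  end.

Definition union_in (n : nat) : X n -> union_upto n :=
  match n with
  | 0 => fun x => x
  | m.+1 => fun x => inl x
  end.

Definition union_bond (n : nat) : union_upto n.+1 -> union_upto n :=
  fun z => match z with
           | inl x => union_in (p x)
           | inr y => y
           end.

Fixpoint union_up (i k : nat) : union_upto i -> union_upto (k + i) :=
  match k with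
  | 0 => fun z => z
  | k'.+1 => fun z => inr (union_up k' z)
  end.

(* The space denoted X with subscript N \cup \infty. *)
Definition union_lim : uniformType := invlim union_bond.

(* The copy of the limit of the X_i inside [union_lim]: the threads whose
   n-th coordinate lies in the summand X_n, for every n. *)
Definition lim_part : set union_lim :=
  [set z | exists x : invlim p,
     forall n, invlim_proj n z = union_in (invlim_proj n x)].

(* The copy of X_i inside [union_lim]: the threads that are constantly equal to
   some x in X_i from index i on; their coordinates of index n < i are then
   forced to be the images of x in X_n. *)
Definition stage_part (i : nat) : set union_lim :=
  [set z | exists x : X i,
     forall k, invlim_proj (k + i)%N z = union_up k (union_in x)].

Definition convergent : Prop :=
  forall U : set union_lim, unif_nbhd lim_part U ->
    \forall i \near \oo, stage_part i `<=` U.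

End convergence.

(* Main.v *)
Require Import Defs.
From mathcomp Require Import all_boot all_order all_algebra.
From mathcomp Require Import all_classical all_reals all_analysis.
From mathcomp Require Import finmap lra.
Import Order.TTheory GRing.Theory Num.Theory.
Local Open Scope classical_set_scope.
Local Open Scope ring_scope.

(** Write [X] for the limit, [x_i] for the [i]-th coordinate of a thread [x].
    Two facts about the sequence carry both parts.

    - Single coordinates determine the uniformity of the limit
      ([entourage_invlim]): since the bonding maps are uniformly continuous,
      finitely many conditions on coordinates can all be moved to one later
      coordinate, so every entourage of [X] contains the preimage of an
      entourage of a single [X_i].

    - Convergence is used in the form of [convergent_approx]: for every
      entourage [E] of [X_i] there is a stage [j] such that each [x] in [X_j]
      has a thread [y] with [y_i] [E]-close to the image of [x] in [X_i].

    For (b), choose [E] so that [E]-close points have images under [f], and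
    under [g], less than [d / 2] apart. The distance between [f] and [g] at the
    image of [x] in [X_i] then exceeds their distance at [y_i] by at most
    [d / 2 + d / 2].

    For (a), uniform continuity of [f] provides [i] and an entourage [E] of
    [X_i] such that threads with [E]-close [i]-th coordinates have close images
    under [f]. A choice of approximating threads [y x] gives a possibly
    discontinuous map [Xi x := f (y x)] on [X_j]. Points of [X_j] with nearby
    images in [X_i] have approximating threads with [E]-close [i]-th
    coordinates, so [Xi] is delta-continuous, and the Hahn property replaces it
    by a uniformly continuous [g]. If [x] is itself the [j]-th coordinate of a
    thread [z], then [z] and [y x] have [E]-close [i]-th coordinates, whence
    [f z], [Xi x] and [g x] are close. *)

Lemma unif_continuous_mdist {R : realType} {U : uniformType} {Y : metricType R}
    {f : U -> Y} (f_unif : unif_continuous f) {e : R} (e_gt0 : 0 < e) :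
  entourage [set u : U * U | mdist (f u.1) (f u.2) < e].
Proof.
have := f_unif _ (entourage_ball Y (PosNum e_gt0)).
by apply: (@filterS _ entourage) => -[x y] /=; rewrite ballEmdist.
Qed.

Section inverse_sequences.
Context {X : nat -> uniformType} {p : forall n, X n.+1 -> X n}.

Lemma invlim_projS (x : invlim p) n :
  p n (invlim_proj n.+1 x) = invlim_proj n x.
Proof. exact: (set_mem (valP x)). Qed.

Lemma bond_invlim_proj (x : invlim p) i m :
  bond p i m (invlim_proj (m + i) x) = invlim_proj i x.
Proof. by elim: m => //= m IH; rewrite invlim_projS. Qed.

Lemma unif_continuous_bond (p_unif : forall n, unif_continuous (p n)) i m :
  unif_continuous (bond p i m).
Proof.
elim: m => [|m IH] E Eent; first by apply: filterS Eent => -[].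
exact: (p_unif _ _ (IH _ Eent)).
Qed.

Lemma unif_continuous_invlim_proj i :
  unif_continuous (@invlim_proj X p i).
Proof.
move=> E Eent.
pose W := [set u : prod_topology X * prod_topology X | E (u.1 i, u.2 i)].
have Went : `[< @entourage (initial_topology (@proj _ X i)) W >].
  by apply/asboolP; exists E => // -[].
exists W; last by move=> -[].
exists W => //.
(* Entourages of the product contain finite intersections of subbasic ones, and
   W is itself subbasic. *)
exists [fset exist _ ((i : {classic nat}), W) Went]%fset.
  by move=> u _; exact: in_setT.
apply/seteqP; split=> [u /(_ (exist _ (i, W) Went))|u Wu ie /=].
  by apply; rewrite /= inE.
by rewrite inE => /eqP ->.
Qed.

(** A finite intersection of conditions on coordinates is implied by one
    condition on a later coordinate, because a condition on [x_k] pulls back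
    along the uniformly continuous bonding map to any [X_j] with [k <= j]. *)
Lemma entourage_invlim (p_unif : forall n, unif_continuous (p n))
    (E : set (invlim p * invlim p)) : entourage E ->
  exists i, exists2 D : set (X i * X i), entourage D &
    forall x y, D (invlim_proj i x, invlim_proj i y) -> E (x, y).
Proof.
move=> [W [V [F _ <-] VW] WE].
suff [i [D Dent DF]] : exists i, exists2 D : set (X i * X i), entourage D &
    forall x y : invlim p, D (invlim_proj i x, invlim_proj i y) ->
    forall ie, ie \in enum_fset F -> (projT1 ie).2 (val x, val y).
  by exists i, D => // x y /DF Dxy; apply: WE; apply: VW => ie; exact: Dxy.
elim: (enum_fset F) => [|[[n A] /= nA] s [i [D Dent Ds]]].
  by exists 0%N, setT => //; exact: entourageT.
have [B Bent BA] : @entourage (initial_topology (@proj _ X n)) A.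
  exact/asboolP.
have lift k j (C : set (X k * X k)) : (k <= j)%N -> entourage C ->
    exists2 C' : set (X j * X j), entourage C' &
      forall x y : invlim p, C' (invlim_proj j x, invlim_proj j y) ->
      C (invlim_proj k x, invlim_proj k y).
  move=> /subnK <- Cent.
  exists [set u | C (bond p k (j - k) u.1, bond p k (j - k) u.2)].
    exact: (unif_continuous_bond p_unif _ _ _ Cent).
  by move=> x y /=; rewrite !bond_invlim_proj.
have [D' D'ent D'D] := lift _ _ _ (leq_addr n i) Dent.
have [B' B'ent B'B] := lift _ _ _ (leq_addl i n) Bent.
exists (i + n)%N, (D' `&` B'); first exact: filterI.
move=> x y [/D'D Dxy /B'B Bxy] ie; rewrite inE => /orP[/eqP -> /=|].
  exact: (BA (val x, val y)).
exact: Ds.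
Qed.

End inverse_sequences.

(** Extends [v] upwards by the sections [s] and downwards by [q]. The spaces and
    maps vary in the induction on [k], whose hypothesis is applied to the
    sequence shifted by one: this keeps the coordinates of [z] free of
    transports along equalities between indices. *)
Lemma thread_through (A : nat -> Type) (q : forall n, A n.+1 -> A n)
    (s : forall n, A n -> A n.+1) (qsK : forall n, cancel (s n) (q n))
    k (v : A k) :
  exists z : forall n, A n, [/\ forall n, q n (z n.+1) = z n, z k = v &
    forall n, (k <= n)%N -> z n.+1 = s n (z n)].
Proof.
elim: k A q s qsK v => [|k IH] A q s qsK v.
  exists (nat_rect A v s); split=> // n; exact: qsK.
have [z [qz zk zs]] := IH (fun n => A n.+1) (fun n => q n.+1)
  (fun n => s n.+1) (fun n => qsK n.+1) v.
exists (fun n => match n return A n with n'.+1 => z n' | 0 => q 0 (z 0) end).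
by split=> // -[|n] // /zs.
Qed.

Section convergent_sequences.
Context {X : nat -> uniformType} {p : forall n, X n.+1 -> X n}.

Lemma bond_union_in i m (x : X (m + i)) :
  bond (union_bond p) i m (union_in x) = union_in (bond p i m x).
Proof. by elim: m x => //= m IH x; rewrite IH. Qed.

(** The copy of [X_k] is defined by threads of the finite unions; without a
    thread for each [x], convergence would say nothing about [x]. *)
Lemma stage_thread k (x : X k) :
  exists2 z : union_lim p, stage_part k z & invlim_proj k z = union_in x.
Proof.
have [z [zP zk zs]] := @thread_through (union_upto X) (union_bond p)
  (fun n => inr) (fun n y => erefl) k (union_in x).
exists (exist _ (z : prod_topology (union_upto X)) (mem_set zP)) => //.
exists x => m; rewrite /invlim_proj/=.
by elim: m => //= m IH; rewrite -IH; apply: zs; exact: leq_addl.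
Qed.

(** The summands are uniformly disjoint, so [D] need only be constrained on
    the summand [X_i]. *)
Lemma entourage_union_in i (E : set (X i * X i)) : entourage E ->
  exists2 D : set (union_upto X i * union_upto X i), entourage D &
    forall x y, D (union_in x, union_in y) -> E (x, y).
Proof.
case: i E => [|i] E Eent; first by exists E.
exists [set u | if u is (inl x, inl y) then E (x, y) else True] => //.
split; first by apply: filterS Eent => -[].
by apply: filterS filterT.
Qed.

(** The threads whose [i]-th coordinate is close to that of a point of the limit
    form a uniform neighborhood [U] of the limit, so [U] contains the copy of
    [X_(m + i)] for some [m]. The thread of [x] in that copy has as its [i]-th
    coordinate the image of [x] in the summand [X_i]. *)
Lemma convergent_approx (p_conv : convergent p) i (E : set (X i * X i)) :
  entourage E ->
  exists m, forall x : X (m + i),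
    exists y : invlim p, E (invlim_proj i y, bond p i m x).
Proof.
move=> /entourage_union_in[D Dent DE].
pose U := [set z : union_lim p |
  exists2 w : union_lim p, lim_part w & D (invlim_proj i w, invlim_proj i z)].
have /p_conv[m _ Um] : unif_nbhd (@lim_part X p) U.
  exists [set u | D (invlim_proj i u.1, invlim_proj i u.2)].
    exact: (@unif_continuous_invlim_proj _ (union_bond p) i _ Dent).
  by move=> w z ? ?; exists w.
exists m => x.
have [z /(Um _ (leq_addr i m))[w [y wy] Dwz] zx] := stage_thread _ x.
by exists y; apply: DE; rewrite -wy -bond_union_in -zx bond_invlim_proj.
Qed.

End convergent_sequences.

(** The cover consists of the sets of points [G]-close to a fixed center, where
    [G] is symmetric and its composite with itself lies in [E]; any two points
    of such a set therefore form a pair in [E]. *)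
Lemma delta_continuous_entourage {R : realType} {Y : metricType R}
    {Z : uniformType} (Xi : Z -> Y) (d : R) (E : set (Z * Z)) :
  entourage E -> (forall x y, E (x, y) -> mdist (Xi x) (Xi y) <= d) ->
  delta_continuous d Xi.
Proof.
move=> Eent EXi; have [D Dent DE] := entourage_split_ex Eent.
pose G := (D `&` D^-1)%relation.
exists (range (fun c => [set x | G (c, x)])).
  exists G; first exact: entourage_invI.
  by move=> x; exists [set y | G (x, y)] => //; exists x.
move=> _ [c _ <-]; apply: ge_ereal_sup => _ [[_ _] [[x [_ cx] <-] [y [cy _] <-]] <-].
by rewrite lee_fin; apply: EXi; apply: DE; exists c.
Qed.

Section approximation.
Context {R : realType} {X : nat -> uniformType} {p : forall n, X n.+1 -> X n}.
Context {Y : metricType R}.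
Context (p_unif : forall n, unif_continuous (p n)) (p_conv : convergent p).

(** Half of [e] pays for replacing [f] by [Xi], the other half for replacing
    [Xi] by [g]. *)
Lemma hahn_factorization (Y_hahn : hahn_property Y) (f : invlim p -> Y) :
  unif_continuous f -> forall e : R, 0 < e ->
  exists (j : nat) (g : X j -> Y),
    unif_continuous g /\ eps_close f (g \o @invlim_proj X p j) e.
Proof.
move=> f_unif e e0; have e20 : 0 < e / 2 by rewrite divr_gt0.
have [d d0 Hd] := Y_hahn _ e20.
(* The bound d makes Xi delta-continuous; e / 2 keeps Xi close to f. *)
have t0 : 0 < Num.min d (e / 2) by rewrite lt_min d0.
have [i [E Eent Ef]] := entourage_invlim p_unif _
  (unif_continuous_mdist f_unif t0).
(* Writing q for the bonding map to X_i, the chain (y a)_i, q a, q b, (y b)_i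
   has three steps, so two successive halvings of E suffice. *)
have [D Dent DE] := entourage_split_ex Eent.
have [C Cent CD] := entourage_split_ex Dent.
pose S := (C `&` C^-1)%relation.
have Sent : entourage S := entourage_invI Cent.
have [m approx] := convergent_approx p_conv _ _ Sent.
have {approx} [y Sy] := choice approx.
pose Xi x := f (y x).
have Xi_cont : delta_continuous d Xi.
  apply: (delta_continuous_entourage Xi d _
    (unif_continuous_bond p_unif i m _ Cent)) => a b /= Cab.
  have [Ca _] := Sy a; have [_ Cb] := Sy b.
  have Eab : E (invlim_proj i (y a), invlim_proj i (y b)).
    apply: DE; exists (bond p i m b); first by apply: CD; exists (bond p i m a).
    by apply: CD; exists (invlim_proj i (y b)) => //; exact: entourage_refl.
  by have := Ef _ _ Eab => /=; rewrite lt_min => /andP[/ltW].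
have [g g_unif gXi] := Hd _ _ Xi_cont.
exists (m + i)%N, g; split=> // x; set xj := invlim_proj (m + i) x.
have [_] := Sy xj; rewrite bond_invlim_proj => Cx.
have Exy : E (invlim_proj i x, invlim_proj i (y xj)).
  by apply: DE; exists (invlim_proj i x); apply: CD;
    [exists (invlim_proj i x); exact: entourage_refl
    |exists (invlim_proj i x) => //; exact: entourage_refl].
have := Ef _ _ Exy; rewrite /= lt_min => /andP[_ fxy].
have := gXi xj; rewrite metric_sym => gxy.
apply: le_trans (metric_triangle _ (Xi xj) _) _.
rewrite (splitr e); apply: lerD => //; exact: ltW.
Qed.

Lemma eps_close_bond i (f g : X i -> Y) :
  unif_continuous f -> unif_continuous g -> forall e : R,
  eps_close (f \o @invlim_proj X p i) (g \o @invlim_proj X p i) e ->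
  forall d : R, 0 < d ->
  exists m, eps_close (f \o bond p i m) (g \o bond p i m) (e + d).
Proof.
move=> f_unif g_unif e fg d d0; have d20 : 0 < d / 2 by rewrite divr_gt0.
have [m approx] := convergent_approx p_conv _ _
  (filterI (unif_continuous_mdist f_unif d20)
           (unif_continuous_mdist g_unif d20)).
exists m => x; have [y /= [fy gy]] := approx x.
have := fg y; rewrite /= => fgy.
have := metric_triangle (f (bond p i m x)) (f (invlim_proj i y))
  (g (bond p i m x)).
have := metric_triangle (f (invlim_proj i y)) (g (invlim_proj i y))
  (g (bond p i m x)).
rewrite (metric_sym (f (bond p i m x)) (f (invlim_proj i y))).
by lra.
Qed.

End approximation.

Theorem lemma16p5 (R : realType) (X : nat -> uniformType)
    (p : forall i, X i.+1 -> X i) (Y : metricType R)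
    (X_metrizable : forall i, unif_metrizable R (X i))
    (p_unif : forall i, unif_continuous (p i))
    (p_convergent : convergent p) :
  (hahn_property Y ->
    forall f : invlim p -> Y, unif_continuous f ->
    forall e : R, 0 < e ->
    exists (j : nat) (g : X j -> Y),
      unif_continuous g /\ eps_close f (g \o @invlim_proj X p j) e) /\
  (forall (i : nat) (f g : X i -> Y),
    unif_continuous f -> unif_continuous g ->
    forall e : R,
    eps_close (f \o @invlim_proj X p i) (g \o @invlim_proj X p i) e ->
    forall d : R, 0 < d ->
    exists m : nat, eps_close (f \o bond p i m) (g \o bond p i m) (e + d)).

Proof.
by split; [exact: hahn_factorization|exact: eps_close_bond].
Qed.
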